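(* Let $\sigma$ be a Kubo-Ando mean on $\mathscr{P}_2(\mathbb{C})$ with representing function $f$, and let $\widetilde{\sigma}$ be the corresponding mean on $\widetilde{\mathscr{P}}_2(\mathbb{C})=\Psi_1(\mathscr{P}_2(\mathbb{C}))\subset\mathscr{P}_4(\mathbb{R})$. Let $X,Y\in\widetilde{\mathscr{P}}_2(\mathbb{C})$ and let $T:=X^{-1/2}YX^{-1/2}$. Assume that $T$ has two distinct eigenvalues $\lambda_+$ and $\lambda_-$, each with multiplicity two. Then $$X\,\widetilde{\sigma}\,Y=\alpha_f(T)X+\beta_f(T)Y,$$ where $$\alpha_f(T)=\frac{\lambda_+f(\lambda_-)-\lambda_-f(\lambda_+)}{\lambda_+-\lambda_-},\qquad \beta_f(T)=\frac{f(\lambda_+)-f(\lambda_-)}{\lambda_+-\lambda_-}.$$ Moreover (with the labelling of the two eigenvalues given by the sign), $$\lambda_\pm=\frac{\tfrac12\mathrm{tr}(T)\pm\sqrt{\left(\tfrac12\mathrm{tr}(T)\right)^2-4\det(T)^{1/2}}}{2}.$$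
   Context: For $\mathbb{D}\in\{\mathbb{R},\mathbb{C}\}$, $A^*$ is the conjugate transpose of $A\in\mathrm{Mat}_n(\mathbb{D})$, and $\mathscr{P}_n(\mathbb{D})$ is the set of $A\in\mathrm{Mat}_n(\mathbb{D})$ with $A=A^*$ and $x^*Ax>0$ for all nonzero $x\in\mathbb{D}^n$. The Loewner order is $A\preceq B$ iff $B-A$ is Hermitian positive semidefinite. For a function $f:(0,+\infty)\to(0,+\infty)$ and $X\in\mathscr{P}_n(\mathbb{D})$, $f(X)$ is defined by the spectral functional calculus, $f(U\,\mathrm{diag}(\lambda_i)\,U^* )=U\,\mathrm{diag}(f(\lambda_i))\,U^*$ with $U$ orthogonal (if $\mathbb{D}=\mathbb{R}$) or unitary (if $\mathbb{D}=\mathbb{C}$); real powers are defined in the same way. The function $f$ is operator monotone if for every $k\ge1$ and all $A\preceq B$ in $\mathscr{P}_k(\mathbb{C})$ one has $f(A)\preceq f(B)$. The map $\Psi_1:\mathrm{Mat}_n(\mathbb{C})\to\mathrm{Mat}_{2n}(\mathbb{R})$ is $\Psi_1(A+iB)=\begin{pmatrix}A&B\\-B&A\end{pmatrix}$ for $A,B\in\mathrm{Mat}_n(\mathbb{R})$; it is an injective algebra morphism and maps $\mathscr{P}_n(\mathbb{C})$ into $\mathscr{P}_{2n}(\mathbb{R})$. A Kubo-Ando mean on $\mathscr{P}_n(\mathbb{D})$ is a continuous map $\sigma:\mathscr{P}_n(\mathbb{D})\times\mathscr{P}_n(\mathbb{D})\to\mathscr{P}_n(\mathbb{D})$ such that: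 (1) $A\preceq B$ and $C\preceq D$ imply $A\,\sigma\,C\preceq B\,\sigma\,D$; (2) $g(A\,\sigma\,B)g^*=(gAg^* )\,\sigma\,(gBg^* )$ for all $g\in\mathrm{GL}_n(\mathbb{D})$ and $A,B\in\mathscr{P}_n(\mathbb{D})$; (3) $\mathrm{Id}_n\,\sigma\,\mathrm{Id}_n=\mathrm{Id}_n$; and which is represented by an operator monotone function $f:(0,+\infty)\to(0,+\infty)$ with $f(1)=1$, i.e. $A\,\sigma\,B=A^{1/2}f(A^{-1/2}BA^{-1/2})A^{1/2}$ for all $A,B\in\mathscr{P}_n(\mathbb{D})$. The function $f$ is unique and is called the representing function of $\sigma$. The mean on $\widetilde{\mathscr{P}}_n(\mathbb{C})=\Psi_1(\mathscr{P}_n(\mathbb{C}))$ corresponding to a Kubo-Ando mean $\sigma$ on $\mathscr{P}_n(\mathbb{C})$ is defined by $X\,\widetilde{\sigma}\,Y=\Psi_1\left(\Psi_1^{-1}(X)\,\sigma\,\Psi_1^{-1}(Y)\right)$. *)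

(* Defs.v *)
From HB Require Import structures.
From mathcomp Require Import all_boot all_order all_algebra.
From mathcomp Require Import sesquilinear.
From mathcomp Require Import all_classical all_reals all_analysis.
From mathcomp Require Import complex.

Set Implicit Arguments.
Unset Strict Implicit.
Unset Printing Implicit Defensive.

Import Order.TTheory GRing.Theory Num.Theory.
Import numFieldNormedType.Exports.

Local Open Scope classical_set_scope.
Local Open Scope ring_scope.
Local Open Scope complex_scope.
Local Open Scope sesquilinear_scope.

(* The scalars D are R or R[i], given by the embedding [iota] of R in D and
   the conjugation [theta] of D, so that [A ^t theta] is A^*.  For D = R[i],
   the order of D as a numFieldType makes 0 < z mean that z is real and
   positive. *)
Section PositiveDefinite.
Context (R : realType) (D : numFieldType) (iota : R -> D) (theta : D -> D).

Definition selfadjoint n (A : 'M[D]_n) : Prop := A = A ^t theta.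

Definition posdef n : set 'M[D]_n :=
  [set A | selfadjoint A /\
    forall x : 'cV[D]_n, x != 0 -> 0 < (x ^t theta *m A *m x) 0 0].

Definition possemidef n : set 'M[D]_n :=
  [set A | selfadjoint A /\
    forall x : 'cV[D]_n, 0 <= (x ^t theta *m A *m x) 0 0].

Definition loewner_le n (A B : 'M[D]_n) : Prop := possemidef (B - A).

(* Z = U diag(f(d_i)) U^* for some decomposition A = U diag(d_i) U^* with U
   orthogonal or unitary. *)
Definition is_fcalc (f : R -> R) n (A Z : 'M[D]_n) : Prop :=
  exists (U : 'M[D]_n) (d : 'rV[R]_n),
    [/\ U *m U ^t theta = 1%:M,
        A = U *m diag_mx (map_mx iota d) *m U ^t theta
      & Z = U *m diag_mx (map_mx (iota \o f) d) *m U ^t theta].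

(* The matrix Z above does not depend on the decomposition; the value is the
   irrelevant default 0 when A has no such decomposition. *)
Definition fcalc (f : R -> R) n (A : 'M[D]_n) : 'M[D]_n :=
  xget 0 [set Z | is_fcalc f A Z].

Definition mxpowR n (A : 'M[D]_n) (r : R) : 'M[D]_n :=
  fcalc (fun t => t `^ r) A.

End PositiveDefinite.

Section Instances.
Context (R : realType).

Definition posdefC n : set 'M[R[i]]_n := @posdef R[i] Num.conj n.

Definition loewner_leC n (A B : 'M[R[i]]_n) : Prop := loewner_le Num.conj A B.

Definition fcalcC (f : R -> R) n (A : 'M[R[i]]_n) : 'M[R[i]]_n :=
  fcalc (real_complex R) Num.conj f A.

Definition mxpowR_real n (A : 'M[R]_n) (r : R) : 'M[R]_n :=
  mxpowR idfun idfun A r.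

(* Functions from (0, +oo) to (0, +oo) are total functions on R whose values
   outside of (0, +oo) are irrelevant. *)
Definition operator_monotone (f : R -> R) : Prop :=
  forall k, (1 <= k)%N -> forall A B : 'M[R[i]]_k,
    posdefC A -> posdefC B -> loewner_leC A B ->
    loewner_leC (fcalcC f A) (fcalcC f B).

End Instances.

Section KuboAndo.
Context (R : realType) (D : numFieldType) (iota : R -> D) (theta : D -> D).
Context (n : nat).
Implicit Types (sigma : 'M[D]_n -> 'M[D]_n -> 'M[D]_n) (f : R -> R).

Local Notation P := (@posdef D theta n).
Local Notation "A <=L B" := (loewner_le theta A B) (at level 70).
Local Notation "A ^[ r ]" := (mxpowR iota theta A r) (at level 8).

Definition representing_function sigma f : Prop :=
  [/\ forall t, 0 < t -> 0 < f t,
      operator_monotone f,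
      f 1 = 1
    & forall A B, P A -> P B ->
        sigma A B =
          A^[2^-1] *m fcalc iota theta f (A^[- 2^-1] *m B *m A^[- 2^-1])
            *m A^[2^-1]].

(* A mean is a total function on matrices; only its values on positive
   definite matrices are constrained. *)
Record kubo_ando_mean sigma : Prop := KuboAndoMean {
  ka_posdef : forall A B, P A -> P B -> P (sigma A B) ;
  ka_continuous :
    {within P `*` P, continuous (fun AB : 'M[D]_n * 'M[D]_n =>
                                   sigma AB.1 AB.2)} ;
  ka_monotone : forall A B C E, P A -> P B -> P C -> P E ->
    A <=L B -> C <=L E -> sigma A C <=L sigma B E ;
  ka_congruence : forall g A B, g \in unitmx -> P A -> P B ->
    g *m sigma A B *m g ^t theta =
      sigma (g *m A *m g ^t theta) (g *m B *m g ^t theta) ;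
  ka_normalized : sigma 1%:M 1%:M = 1%:M ;
  ka_represented : exists f, representing_function sigma f
}.

End KuboAndo.

Section Psi1.
Context (R : realType) (n : nat).

Definition Psi1 (A : 'M[R[i]]_n) : 'M[R]_(n + n) :=
  block_mx (map_mx (@complex.Re R) A) (map_mx (@complex.Im R) A)
           (- map_mx (@complex.Im R) A) (map_mx (@complex.Re R) A).

Definition Psi1_inv (Z : 'M[R]_(n + n)) : 'M[R[i]]_n :=
  \matrix_(i, j) (ulsubmx Z i j +i* ursubmx Z i j).

Lemma Psi1K : cancel Psi1 Psi1_inv.
Proof.
move=> A; apply/matrixP => i j.
by rewrite /Psi1_inv /Psi1 mxE block_mxKul block_mxKur !mxE; case: (A i j).
Qed.

Definition posdef_tilde : set 'M[R]_(n + n) := Psi1 @` @posdefC R n.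

Definition mean_tilde (sigma : 'M[R[i]]_n -> 'M[R[i]]_n -> 'M[R[i]]_n)
    (X Y : 'M[R]_(n + n)) : 'M[R]_(n + n) :=
  Psi1 (sigma (Psi1_inv X) (Psi1_inv Y)).

Definition kubo_ando_meanC (sigma : 'M[R[i]]_n -> 'M[R[i]]_n -> 'M[R[i]]_n) :=
  kubo_ando_mean (real_complex R) Num.conj sigma.

Definition representing_functionC
    (sigma : 'M[R[i]]_n -> 'M[R[i]]_n -> 'M[R[i]]_n) (f : R -> R) :=
  representing_function (real_complex R) Num.conj sigma f.

End Psi1.

Definition eigenvalue_of_mult (F : fieldType) n (A : 'M[F]_n) (a : F)
    (m : nat) : Prop :=
  eigenvalue A a /\ mup a (char_poly A) = m.

(* Main.v *)
Require Import Defs.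
From mathcomp Require Import all_boot all_order all_algebra.
From mathcomp Require Import sesquilinear spectral.
From mathcomp Require Import all_classical all_reals all_analysis.
From mathcomp Require Import complex ring.

(** Write X = Psi1 A and Y = Psi1 B, let S = A^(-1/2), Q = A^(1/2) and
    M = S B S, a positive definite matrix of size 2.

    Since Psi1 is a morphism of *-algebras over R, it carries a unitary
    diagonalisation U diag(d) U^* to the orthogonal diagonalisation
    Psi1(U) diag(d, d) Psi1(U)^T; hence it commutes with the functional
    calculus ([Psi1_fcalc]), and T = Psi1 M has as eigenvalues those of M, each
    repeated twice.  As T has two distinct eigenvalues and M has only two in
    all, the spectrum of M is exactly {lp, lm}.

    On a two-point spectrum every function agrees with its Lagrange
    interpolant, here t |-> alpha + beta t, so f(M) = alpha 1 + beta M
    ([spectral_form_affine]).  Multiplying by Q on both sides gives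
    sigma A B = Q f(M) Q = alpha A + beta B, because Q Q = A and Q S = 1
    ([congruence_affine]); applying Psi1 yields the formula for the mean.

    Finally tr T = 2 (lp + lm) and det T = (lp lm)^2, where lp lm > 0 because M
    is positive definite; so lp and lm are the roots of
    t^2 - (tr T / 2) t + det(T)^(1/2), whose discriminant is (lp - lm)^2. *)

Import Order.TTheory GRing.Theory Num.Theory.

Local Open Scope ring_scope.
Local Open Scope complex_scope.
Local Open Scope sesquilinear_scope.

Set Implicit Arguments.
Unset Strict Implicit.
Unset Printing Implicit Defensive.

(** * Functional calculus on a diagonalised matrix *)

Section SpectralForm.
Context (R : realType) (D : numFieldType) (iota : {rmorphism R -> D}).
Context (theta : D -> D) (n : nat).
Implicit Types (U : 'M[D]_n) (d : 'rV[R]_n) (f g : R -> R).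

Definition spectral_form U d : 'M[D]_n :=
  U *m diag_mx (map_mx iota d) *m U ^t theta.

(** Entrywise, W i j * d j = e i * W i j forces d j = e i wherever W i j is
    nonzero; this is what makes the functional calculus independent of the
    chosen diagonalisation. *)
Lemma intertwining_diag_mx f (W : 'M[D]_n) d e :
  W *m diag_mx (map_mx iota d) = diag_mx (map_mx iota e) *m W ->
  W *m diag_mx (map_mx iota (map_mx f d)) =
  diag_mx (map_mx iota (map_mx f e)) *m W.
Proof.
move=> /matrixP WE; apply/matrixP => i j; have := WE i j.
rewrite !mul_mx_diag !mul_diag_mx !mxE.
have [->|W0] := eqVneq (W i j) 0; first by rewrite !mul0r !mulr0.
by rewrite mulrC => /(mulIf W0)/fmorph_inj ->; rewrite mulrC.
Qed.

(** Two diagonalisations U diag(d) U^* = V diag(e) V^* are intertwined by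
    W = V^* U, so [intertwining_diag_mx] leaves a single candidate for the
    value of f. *)
Lemma fcalc_spectral_form f U d : U *m U ^t theta = 1%:M ->
  fcalc iota theta f (spectral_form U d) = spectral_form U (map_mx f d).
Proof.
move=> UU1; rewrite /fcalc; apply: xget_unique.
  by exists U, d; split; rewrite // map_mx_comp.
move=> _ [V [e [VV1 UdVe ->]]].
have U1 := mulmx1C UU1; have V1 := mulmx1C VV1.
pose W := V ^t theta *m U.
have WE : W *m diag_mx (map_mx iota d) = diag_mx (map_mx iota e) *m W.
  rewrite /W -[LHS]mulmx1 -U1 !mulmxA.
  have := congr1 (fun M => V ^t theta *m M *m U) UdVe.
  by rewrite /spectral_form !mulmxA V1 mul1mx.
have WfE := intertwining_diag_mx f WE.
have := congr1 (fun M => V *m M *m U ^t theta) WfE.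
rewrite /W !mulmxA VV1 mul1mx -/(spectral_form _ _) => ->.
rewrite -map_mx_comp.
by rewrite -!mulmxA UU1 mulmx1.
Qed.

Lemma spectral_formM U d f g : U *m U ^t theta = 1%:M ->
  spectral_form U (map_mx f d) *m spectral_form U (map_mx g d) =
  spectral_form U (map_mx (f \* g) d).
Proof.
move=> /mulmx1C U1; rewrite /spectral_form !mulmxA.
congr (_ *m _); rewrite -!mulmxA (mulmxA (U ^t theta)) U1 mul1mx mulmx_diag.
by congr (_ *m diag_mx _); apply/rowP => j; rewrite !mxE rmorphM.
Qed.

Lemma spectral_form_const U d f c : U *m U ^t theta = 1%:M ->
  (forall j, f (d 0 j) = c) -> spectral_form U (map_mx f d) = (iota c)%:M.
Proof.
move=> UU1 fc; have -> : map_mx f d = const_mx c.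
  by apply/rowP => j; rewrite !mxE fc.
rewrite /spectral_form map_const_mx diag_const_mx scalar_mxC.
by rewrite -mulmxA UU1 mulmx1.
Qed.

Lemma spectral_form_affine U d f a b : U *m U ^t theta = 1%:M ->
  (forall j, f (d 0 j) = a + b * d 0 j) ->
  spectral_form U (map_mx f d) = (iota a)%:M + iota b *: spectral_form U d.
Proof.
move=> UU1 fd; rewrite -(spectral_form_const UU1 (f := fun=> a) (d := d)) //.
rewrite /spectral_form scalemxAl scalemxAr -mulmxDl -mulmxDr.
congr (_ *m _ *m _); apply/matrixP => i j; rewrite !mxE fd.
by rewrite rmorphD rmorphM mulrnDl mulrnAr.
Qed.

(** A left eigenvector v becomes a nonzero row v U on which diag(d) acts as the
    scalar a; any nonzero entry of it locates a in d. *)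
Lemma eigenvalue_spectral_form U d a : U *m U ^t theta = 1%:M ->
  eigenvalue (spectral_form U d) (iota a) -> exists j, d 0 j = a.
Proof.
move=> UU1 /eigenvalueP[v vE v0].
pose w := v *m U.
have wE : w *m diag_mx (map_mx iota d) = iota a *: w.
  rewrite /w -[LHS]mulmx1 -(mulmx1C UU1) scalemxAl -vE /spectral_form.
  by rewrite !mulmxA.
have /rV0Pn[j wj] : w != 0.
  apply: contraNneq v0 => w0; rewrite -[v]mulmx1 -UU1 mulmxA -/w w0.
  by rewrite mul0mx.
exists j; move: w wE wj => w /rowP/(_ j) wE wj; move: wE.
by rewrite mul_mx_diag !mxE mulrC => /(mulIf wj)/fmorph_inj.
Qed.

Lemma mxtrace_spectral_form U d : U *m U ^t theta = 1%:M ->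
  \tr (spectral_form U d) = iota (\sum_j d 0 j).
Proof.
move=> /mulmx1C U1; rewrite /spectral_form mxtrace_mulC mulmxA U1 mul1mx.
by rewrite mxtrace_diag rmorph_sum; apply: eq_bigr => j _; rewrite mxE.
Qed.

Lemma det_spectral_form U d : U *m U ^t theta = 1%:M ->
  \det (spectral_form U d) = iota (\prod_j d 0 j).
Proof.
move=> UU1; rewrite /spectral_form !det_mulmx mulrAC -det_mulmx UU1 det1 mul1r.
by rewrite det_diag rmorph_prod; apply: eq_bigr => j _; rewrite mxE.
Qed.

End SpectralForm.

Arguments fcalc_spectral_form {R D iota theta n f U d}.
Arguments spectral_formM {R D iota theta n U d f g}.
Arguments spectral_form_const {R D iota theta n U d f c}.
Arguments spectral_form_affine {R D iota theta n U d f a b}.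
Arguments eigenvalue_spectral_form {R D iota theta n U d a}.
Arguments mxtrace_spectral_form {R D iota theta n U d}.
Arguments det_spectral_form {R D iota theta n U d}.

(** * Powers of complex positive definite matrices *)

Section ComplexPositiveDefinite.
Context (R : realType) (n : nat).
Implicit Types (A B S : 'M[R[i]]_n).

Local Notation form := (spectral_form (real_complex R) Num.conj).
Local Notation "A ^[ r ]" :=
  (mxpowR (real_complex R) Num.conj A r) (at level 8).

(** The spectral theorem for Hermitian matrices; evaluating the form of A at
    the eigenvector U e_j gives d_j, which is therefore positive. *)
Lemma posdefC_spectral_form A : posdefC A ->
  exists U (d : 'rV[R]_n), [/\ U *m U ^t Num.conj = 1%:M, A = form U d
    & forall j, 0 < d 0 j].
Proof.
case=> Asa Apos.
have Aherm : A \is hermsymmx by rewrite is_hermitianmxE expr0 scale1r -Asa.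
have AE := orthomx_spectralP (hermitian_normalmx Aherm).
have /mxOverP dreal := hermitian_spectral_diag_real Aherm.
have Punit := spectral_unitarymx A.
set P := spectralmx A in AE Punit *; set sp := spectral_diag A in AE dreal.
pose d := map_mx (@complex.Re R) sp.
have dE : map_mx (real_complex R) d = sp.
  by apply/rowP => j; rewrite !mxE RRe_real.
(* P diagonalises in the opposite order, A = P^-1 diag(sp) P, so U is P^*. *)
exists (P ^t*), d; rewrite trmxCK.
have PP1 : P ^t* *m P = 1%:M by apply/mulmx1C/unitarymxP.
have AE' : A = form (P ^t*) d.
  by rewrite /spectral_form trmxCK dE {1}AE invmx_unitary.
split=> // j.
pose x : 'cV[R[i]]_n := P ^t* *m delta_mx j 0.
have x0 : x != 0.
  apply/eqP => /(congr1 (mulmx P)); rewrite mulmxA mulmx0.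
  rewrite (mulmx1C PP1) mul1mx => /matrixP/(_ j 0).
  by rewrite !mxE !eqxx => /eqP; rewrite oner_eq0.
have := Apos x x0.
rewrite AE' /spectral_form trmxCK dE.
have -> : x ^t Num.conj = delta_mx 0 j *m P.
  rewrite /x trmx_mul map_mxM trmxCK; congr (_ *m _).
  by rewrite trmx_delta; apply/matrixP => a b; rewrite !mxE rmorph_nat.
rewrite /x !mulmxA -[_ *m P *m P ^t*]mulmxA (mulmx1C PP1) mulmx1.
rewrite -[_ *m P *m P ^t*]mulmxA (mulmx1C PP1) mulmx1.
rewrite -rowE -colE !mxE eqxx mulr1n -(RRe_real (dreal 0 j)).
by rewrite ltcR.
Qed.

Lemma posdefC_congruence S B : S = S ^t Num.conj -> S \in unitmx ->
  posdefC B -> posdefC (S *m B *m S).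
Proof.
move=> Ssa Sunit [Bsa Bpos]; split.
  by rewrite /selfadjoint !trmx_mul !map_mxM -Ssa -Bsa mulmxA.
move=> x x0; have -> : x ^t Num.conj *m (S *m B *m S) *m x =
    (S *m x) ^t Num.conj *m B *m (S *m x).
  by rewrite trmx_mul map_mxM -Ssa !mulmxA.
apply: Bpos; apply: contraNneq x0 => Sx0.
by rewrite -[x](mulKmx Sunit) Sx0 mulmx0.
Qed.

Lemma spectral_form_selfadjoint U (d : 'rV[R]_n) :
  form U d = (form U d) ^t Num.conj.
Proof.
rewrite /spectral_form !trmx_mul !map_mxM trmxCK mulmxA; congr (_ *m _ *m _).
rewrite tr_diag_mx map_diag_mx -map_mx_comp; congr diag_mx.
by apply/rowP => j; rewrite !mxE /= -[LHS]conjc_real.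
Qed.

Lemma posdefC_mxpowRD A (r s : R) : posdefC A ->
  A^[r] *m A^[s] = A^[r + s].
Proof.
case/posdefC_spectral_form => U [d [UU1 -> d0]].
rewrite /mxpowR !(fcalc_spectral_form UU1) (spectral_formM UU1).
congr (form _ _); apply/rowP => j; rewrite !mxE.
by rewrite powRD // (gt_eqF (d0 j)) implybT.
Qed.

Lemma posdefC_mxpowR0 A : posdefC A -> A^[0] = 1%:M.
Proof.
case/posdefC_spectral_form => U [d [UU1 -> d0]].
rewrite /mxpowR (fcalc_spectral_form UU1) (spectral_form_const UU1 (c := 1)) //.
by move=> j; rewrite powRr0.
Qed.

Lemma posdefC_mxpowR1 A : posdefC A -> A^[1] = A.
Proof.
case/posdefC_spectral_form => U [d [UU1 -> d0]].
rewrite /mxpowR (fcalc_spectral_form UU1).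
by congr (form _ _); apply/rowP => j; rewrite !mxE powRr1 // ltW.
Qed.

Lemma posdefC_mxpowR_selfadjoint A (r : R) : posdefC A ->
  A^[r] = A^[r] ^t Num.conj.
Proof.
case/posdefC_spectral_form => U [d [UU1 -> d0]].
by rewrite /mxpowR (fcalc_spectral_form UU1) -spectral_form_selfadjoint.
Qed.

Lemma posdefC_mxpowR_unit A (r : R) : posdefC A -> A^[r] \in unitmx.
Proof.
move=> pA; have AA1 : A^[r] *m A^[- r] = 1%:M.
  by rewrite (posdefC_mxpowRD _ _ pA) subrr (posdefC_mxpowR0 pA).
have [Aunit _] := mulmx1_unit AA1.
exact: Aunit.
Qed.

End ComplexPositiveDefinite.

(** * Psi1 as a morphism of star-algebras *)

Section Psi1Morphism.
Context (R : realType) (n : nat).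
Implicit Types (A B : 'M[R[i]]_n).

Lemma Psi1M A B : Psi1 (A *m B) = Psi1 A *m Psi1 B.
Proof.
rewrite /Psi1 mulmx_block.
have ReM : map_mx (@complex.Re R) (A *m B) =
    map_mx (@complex.Re R) A *m map_mx (@complex.Re R) B
    - map_mx (@complex.Im R) A *m map_mx (@complex.Im R) B.
  apply/matrixP => i j; rewrite !mxE raddf_sum -sumrB /=; apply: eq_bigr => k _.
  by rewrite !mxE; case: (A i k) (B k j) => ? ? [].
have ImM : map_mx (@complex.Im R) (A *m B) =
    map_mx (@complex.Re R) A *m map_mx (@complex.Im R) B
    + map_mx (@complex.Im R) A *m map_mx (@complex.Re R) B.
  apply/matrixP => i j; rewrite !mxE raddf_sum -big_split /=.
  apply: eq_bigr => k _.
  by rewrite !mxE; case: (A i k) (B k j) => ? ? [].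
congr block_mx; rewrite ?ReM ?ImM ?mulNmx ?mulmxN //.
  by rewrite opprD addrC.
by rewrite addrC.
Qed.

Lemma Psi1D A B : Psi1 (A + B) = Psi1 A + Psi1 B.
Proof. by rewrite /Psi1 add_block_mx -opprD -!map_mxD. Qed.

Lemma Psi1Z (a : R) A : Psi1 (a%:C *: A) = a *: Psi1 A.
Proof.
rewrite /Psi1 scale_block_mx scalerN.
have ReZ : map_mx (@complex.Re R) (a%:C *: A) = a *: map_mx (@complex.Re R) A.
  apply/matrixP => i j; rewrite !mxE.
  by case: (A i j) => x y /=; rewrite mul0r subr0.
have ImZ : map_mx (@complex.Im R) (a%:C *: A) = a *: map_mx (@complex.Im R) A.
  apply/matrixP => i j; rewrite !mxE.
  by case: (A i j) => x y /=; rewrite mul0r addr0.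
by rewrite ReZ ImZ.
Qed.

Lemma Psi1_adjoint A : Psi1 (A ^t Num.conj) = Psi1 A ^t idfun.
Proof.
rewrite [RHS]map_mx_id // /Psi1 tr_block_mx linearN /=.
congr block_mx; apply/matrixP => i j; rewrite !mxE;
  by case: (A j i) => x y //=; rewrite ?opprK.
Qed.

Lemma Psi1_diag (d : 'rV[R]_n) :
  Psi1 (diag_mx (map_mx (real_complex R) d)) = diag_mx (row_mx d d).
Proof.
rewrite diag_mx_row /Psi1.
have ReE :
    map_mx (@complex.Re R) (diag_mx (map_mx (real_complex R) d)) = diag_mx d.
  by apply/matrixP => i j; rewrite !mxE raddfMn.
have ImE : map_mx (@complex.Im R) (diag_mx (map_mx (real_complex R) d)) = 0.
  by apply/matrixP => i j; rewrite !mxE raddfMn /= mul0rn.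
by rewrite ReE ImE oppr0.
Qed.

Lemma Psi1_1 : Psi1 (1%:M : 'M[R[i]]_n) = 1%:M.
Proof.
have -> : 1%:M = diag_mx (map_mx (real_complex R) (const_mx 1)) :> 'M[R[i]]_n.
  by rewrite map_const_mx diag_const_mx.
by rewrite Psi1_diag row_mx_const diag_const_mx.
Qed.

Lemma Psi1_orthogonal (U : 'M[R[i]]_n) : U *m U ^t Num.conj = 1%:M ->
  Psi1 U *m Psi1 U ^t idfun = 1%:M.
Proof. by move=> UU1; rewrite -Psi1_adjoint -Psi1M UU1 Psi1_1. Qed.

Lemma Psi1_spectral_form (U : 'M[R[i]]_n) (d : 'rV[R]_n) :
  Psi1 (spectral_form (real_complex R) Num.conj U d) =
  spectral_form idfun idfun (Psi1 U) (row_mx d d).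
Proof.
rewrite /spectral_form !Psi1M Psi1_adjoint Psi1_diag.
by rewrite [map_mx idfun (row_mx _ _)]map_mx_id.
Qed.

(** Psi1 sends a unitary diagonalisation of A to an orthogonal one of Psi1 A in
    which every eigenvalue is duplicated, and applying f entrywise commutes
    with this duplication.  With f a power, it identifies the powers of
    Psi1 A with the images of those of A. *)
Lemma Psi1_fcalc A (f : R -> R) : posdefC A ->
  Psi1 (fcalcC f A) = fcalc idfun idfun f (Psi1 A).
Proof.
case/posdefC_spectral_form => U [d [UU1 -> _]].
rewrite /fcalcC (fcalc_spectral_form UU1).
apply: etrans (Psi1_spectral_form U (map_mx f d)) _.
rewrite Psi1_spectral_form (fcalc_spectral_form (Psi1_orthogonal UU1)).
by rewrite map_row_mx.
Qed.

End Psi1Morphism.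

(** * The mean as an affine combination *)

(** With Q = A^(1/2) and S = A^(-1/2), this is the reason why an affine
    representing function a + b t yields the mean a A + b B. *)
Lemma congruence_affine (K : comUnitRingType) n (Q S B : 'M[K]_n) (a b : K) :
  Q *m S = 1%:M ->
  Q *m (a%:M + b *: (S *m B *m S)) *m Q = a *: (Q *m Q) + b *: B.
Proof.
move=> QS; rewrite mulmxDr mulmxDl mul_mx_scalar -scalemxAl -scalemxAr.
rewrite -(scalemxAl b); congr (_ + _ *: _).
by rewrite !mulmxA QS mul1mx -mulmxA (mulmx1C QS) mulmx1.
Qed.

Theorem proposition5p5 (R : realType)
    (sigma : 'M[R[i]]_2 -> 'M[R[i]]_2 -> 'M[R[i]]_2) (f : R -> R)
    (X Y : 'M[R]_(2 + 2)) (lp lm : R) :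
  kubo_ando_meanC sigma ->
  representing_functionC sigma f ->
  posdef_tilde X -> posdef_tilde Y ->
  let T := mxpowR_real X (- 2^-1) *m Y *m mxpowR_real X (- 2^-1) in
  lp != lm ->
  eigenvalue_of_mult T lp 2 -> eigenvalue_of_mult T lm 2 ->
  let alpha := (lp * f lm - lm * f lp) / (lp - lm) in
  let beta := (f lp - f lm) / (lp - lm) in
  let disc := (2^-1 * \tr T) ^+ 2 - 4 * Num.sqrt (\det T) in
  mean_tilde sigma X Y = alpha *: X + beta *: Y /\
  (lm < lp ->
     lp = (2^-1 * \tr T + Num.sqrt disc) / 2 /\
     lm = (2^-1 * \tr T - Num.sqrt disc) / 2).
Proof.
move=> _ [_ _ _ sigmaE] [A pA <-] [B pB <-] T lpm [Tlp _] [Tlm _].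
move=> alpha beta disc.
pose S := mxpowR (real_complex R) Num.conj A (- 2^-1).
pose Q := mxpowR (real_complex R) Num.conj A 2^-1.
have QS : Q *m S = 1%:M.
  by rewrite /Q /S (posdefC_mxpowRD _ _ pA) subrr (posdefC_mxpowR0 pA).
have QQ : Q *m Q = A.
  have half2 : 2^-1 + 2^-1 = 1 :> R by field.
  by rewrite /Q (posdefC_mxpowRD _ _ pA) half2 (posdefC_mxpowR1 pA).
have pM : posdefC (S *m B *m S).
  apply: posdefC_congruence pB.
    exact: (posdefC_mxpowR_selfadjoint _ pA).
  exact: (posdefC_mxpowR_unit _ pA).
have TE : T = Psi1 (S *m B *m S).
  by rewrite /T /mxpowR_real /mxpowR -!(Psi1_fcalc _ pA) -!Psi1M.
have [U [d [UU1 ME d0]]] := posdefC_spectral_form pM.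
rewrite ME Psi1_spectral_form in TE.
have VV1 := Psi1_orthogonal UU1.
(* The spectrum (d, d) of T lists the two eigenvalues of M twice. *)
have spec a : eigenvalue T a -> a = d 0 0 \/ a = d 0 1.
  rewrite TE => /(eigenvalue_spectral_form VV1)[j <-].
  have dE (k : 'I_2) : d 0 k = d 0 0 \/ d 0 k = d 0 1.
    by case: k => [[|[]]] //= k2; [left|right]; congr (d _ _); apply: val_inj.
  by rewrite mxE; case: splitP => k _.
have [sumE prodE dE] : [/\ d 0 0 + d 0 1 = lp + lm, d 0 0 * d 0 1 = lp * lm
    & forall j, d 0 j = lp \/ d 0 j = lm].
  have swap (P : 'I_2 -> Prop) : P 0 -> P 1 -> forall j, P j.
    move=> P0 P1 [[|[]]] //= k2.
      by rewrite (_ : Ordinal k2 = 0) //; apply: val_inj.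
    by rewrite (_ : Ordinal k2 = 1) //; apply: val_inj.
  case: (spec _ Tlp) (spec _ Tlm) lpm => -> [] ->; rewrite ?eqxx // => _.
    by split=> //; apply: swap; [left|right].
  by split; [rewrite addrC|rewrite mulrC|apply: swap; [right|left]].
have lpm0 : lp - lm != 0 by rewrite subr_eq0.
split.
  (* alpha + beta t interpolates f at lp and lm, hence on the spectrum of M. *)
  have fM : fcalc (real_complex R) Num.conj f (S *m B *m S) =
      alpha%:C%:M + beta%:C *: (S *m B *m S).
    rewrite ME (fcalc_spectral_form UU1).
    apply: (spectral_form_affine UU1) => j.
    by rewrite /alpha /beta; case: (dE j) => ->; field.
  rewrite /mean_tilde !Psi1K (sigmaE _ _ pA pB) -/S -/Q fM.
  by rewrite (congruence_affine _ _ _ QS) QQ Psi1D !Psi1Z.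
have dsum : \sum_j row_mx d d 0 j = 2 * (lp + lm).
  rewrite big_split_ord /=.
  under eq_bigr => i _ do rewrite row_mxEl.
  under [X in _ + X]eq_bigr => i _ do rewrite row_mxEr.
  rewrite big_ord_recl big_ord1 (_ : lift _ _ = 1); last exact: val_inj.
  by rewrite sumE; ring.
have dprod : \prod_j row_mx d d 0 j = (lp * lm) ^+ 2.
  rewrite big_split_ord /=.
  under eq_bigr => i _ do rewrite row_mxEl.
  under [X in _ * X]eq_bigr => i _ do rewrite row_mxEr.
  rewrite big_ord_recl big_ord1 (_ : lift _ _ = 1); last exact: val_inj.
  by rewrite prodE; ring.
have trT : 2^-1 * \tr T = lp + lm.
  by rewrite TE (mxtrace_spectral_form VV1) dsum /=; field.
have detT : Num.sqrt (\det T) = lp * lm.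
  rewrite TE (det_spectral_form VV1) dprod /= sqrtr_sqr ger0_norm //.
  by rewrite -prodE mulr_ge0 // ltW.
move=> ltml.
have discE : Num.sqrt disc = lp - lm.
  rewrite /disc trT detT (_ : _ - _ = (lp - lm) ^+ 2); last by ring.
  by rewrite sqrtr_sqr ger0_norm // subr_ge0 ltW.
by rewrite discE trT; split; field.
Qed.
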